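(* Let $A\in\mathbb{R}^{n\times n}$, $B\in\mathbb{R}^{n\times m}$, $C\in\mathbb{R}^{p\times n}$, let $T\ge n$, and let $X\in\mathbb{R}^{nT\times N}$, $X_0\in\mathbb{R}^{n\times N}$, $U\in\mathbb{R}^{mT\times N}$, $Y\in\mathbb{R}^{pT\times N}$ be the state, initial-state, input and output data matrices of $N$ experiments of horizon $T$ on the system $x(t+1)=Ax(t)+Bu(t)$, $y(t)=Cx(t)$. Assume the data are persistently exciting, i.e. $\operatorname{rank}\begin{bmatrix}X_0 \\ U\end{bmatrix}=n+mT$. Let $K_0$ be a matrix whose columns form a basis of $\operatorname{Ker}(X_0)$, and let $H=[0_n\ \cdots\ 0_n\ I_n]\in\mathbb{R}^{n\times nT}$ (a row of $T$ blocks of size $n\times n$, the last being the identity and the others zero). Then the smallest $(A,\operatorname{Ker}(C))$-conditioned invariant subspace $\mathcal{S}^*$ containing $\operatorname{Im}(B)$ is $$\mathcal{S}^*=HXK_0\operatorname{Ker}(YK_0).$$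
   Context: A subspace $\mathcal{S}\subseteq\mathbb{R}^n$ is $(A,\operatorname{Ker}(C))$-conditioned invariant if $A(\mathcal{S}\cap\operatorname{Ker}(C))\subseteq\mathcal{S}$. $\mathcal{S}^*$ denotes the smallest such subspace containing $\operatorname{Im}(B)$. Data: for $i=1,\dots,N$, the system is run from initial state $x_0^i\in\mathbb{R}^n$ with inputs $u^i(0),\dots,u^i(T-1)\in\mathbb{R}^m$, giving states $x^i(t)$ and outputs $y^i(t)=Cx^i(t)$. Set $X_T^i=[x^i(1)^\top\cdots x^i(T)^\top]^\top$, $U_T^i=[u^i(0)^\top\cdots u^i(T-1)^\top]^\top$ and $Y_T^i=[y^i(0)^\top\cdots y^i(T-1)^\top]^\top$. Then $X=[X_T^1\cdots X_T^N]$, $X_0=[x_0^1\cdots x_0^N]$, $U=[U_T^1\cdots U_T^N]$, $Y=[Y_T^1\cdots Y_T^N]$. For a matrix $M$ and a subspace $\mathcal{W}$, $M\mathcal{W}=\{Mw: w\in\mathcal{W}\}$. *)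

(* Defs.v *)
From mathcomp Require Import all_boot all_order all_algebra.
From mathcomp Require Import reals.

Set Implicit Arguments.
Unset Strict Implicit.
Unset Printing Implicit Defensive.

Import Order.TTheory GRing.Theory Num.Theory.
Local Open Scope ring_scope.

(* Subspaces of R^q are taken in {vspace 'cV[R]_q}; a matrix acts on column
   vectors by left multiplication (and not on row vectors, as in mxalgebra). *)
Definition mxmap (R : fieldType) (r q : nat) (M : 'M[R]_(r, q)) :
  'Hom('cV[R]_q, 'cV[R]_r) := linfun (mulmx M).

Definition Ker (R : fieldType) (r q : nat) (M : 'M[R]_(r, q)) :
  {vspace 'cV[R]_q} := lker (mxmap M).

Definition Im (R : fieldType) (r q : nat) (M : 'M[R]_(r, q)) :
  {vspace 'cV[R]_r} := limg (mxmap M).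

Definition mximage (R : fieldType) (r q : nat) (M : 'M[R]_(r, q))
  (W : {vspace 'cV[R]_q}) : {vspace 'cV[R]_r} := (mxmap M @: W)%VS.

Definition conditioned_invariant (R : fieldType) (n p : nat) (A : 'M[R]_n)
  (C : 'M[R]_(p, n)) (S : {vspace 'cV[R]_n}) : Prop :=
  (mximage A (S :&: Ker C) <= S)%VS.

Definition smallest_conditioned_invariant (R : fieldType) (n m p : nat)
  (A : 'M[R]_n) (B : 'M[R]_(n, m)) (C : 'M[R]_(p, n))
  (S : {vspace 'cV[R]_n}) : Prop :=
  [/\ conditioned_invariant A C S,
      (Im B <= S)%VS
    & forall V : {vspace 'cV[R]_n},
        conditioned_invariant A C V -> (Im B <= V)%VS -> (S <= V)%VS].

(* The values of the signals after time T are left unconstrained. *)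
Definition experiment (R : fieldType) (n m p T : nat)
  (A : 'M[R]_n) (B : 'M[R]_(n, m)) (C : 'M[R]_(p, n))
  (x : nat -> 'cV[R]_n) (u : nat -> 'cV[R]_m) (y : nat -> 'cV[R]_p) : Prop :=
  forall t : nat, (t < T)%N ->
    x t.+1 = A *m x t + B *m u t /\ y t = C *m x t.

(* [z(0)^T ... z(T-1)^T]^T; the number of rows \sum_(t < T) q is T * q. *)
Definition stack (R : fieldType) (q T : nat) (z : nat -> 'cV[R]_q) :
  'cV[R]_(\sum_(t < T) q) := \mxcol_(t < T) z t.

Definition columns (R : fieldType) (q N : nat) (v : 'I_N -> 'cV[R]_q) :
  'M[R]_(q, N) := \matrix_(j < q, i < N) v i j 0.

Definition last_block (R : fieldType) (n T : nat) :
  'M[R]_(n, \sum_(t < T) n) :=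
  \mxrow_(t < T) (if t.+1 == T then 1%:M else 0 : 'M[R]_n).

(* Main.v *)
Require Import Defs.
From mathcomp Require Import all_boot all_order all_algebra.
From mathcomp Require Import reals.

Set Implicit Arguments.
Unset Strict Implicit.
Unset Printing Implicit Defensive.

Import Order.TTheory GRing.Theory Num.Theory.
Local Open Scope ring_scope.

(** Let [S_0 = 0] and [S_(t+1) = A (S_t :&: Ker C) + Im B]. This sequence is
    increasing and each [S_t] lies in every conditioned invariant subspace that
    contains [Im B]; since dimensions are at most [n], it is stationary from
    [t = n] on, so [S_T] is the smallest one. On the other hand [S_T] is the set
    of states reached at time [T] from [0] along trajectories whose output
    vanishes before [T]. By persistence of excitation every trajectory starting
    at [0] is a combination of the experiments with coefficients in [Ker X0],
    that is, in [Im K0]. *)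

Lemma mxmapE (F : fieldType) r q (M : 'M[F]_(r, q)) (v : 'cV[F]_q) :
  mxmap M v = M *m v.
Proof. by rewrite /mxmap lfunE. Qed.

Lemma mem_Ker (F : fieldType) r q (M : 'M[F]_(r, q)) (v : 'cV[F]_q) :
  (v \in Ker M) = (M *m v == 0).
Proof. by rewrite /Ker memv_ker mxmapE. Qed.

Lemma mem_mximageP (F : fieldType) r q (M : 'M[F]_(r, q))
    (W : {vspace 'cV[F]_q}) (v : 'cV[F]_r) :
  reflect (exists2 w, w \in W & v = M *m w) (v \in mximage M W).
Proof.
apply: (iffP memv_imgP) => -[w wW ->]; exists w => //; by rewrite mxmapE.
Qed.

Lemma mem_ImP (F : fieldType) r q (M : 'M[F]_(r, q)) (v : 'cV[F]_r) :
  reflect (exists w, v = M *m w) (v \in Defs.Im M).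
Proof.
apply: (iffP (mem_mximageP M fullv v)) => [[w _ ->]|[w ->]]; first by exists w.
by exists w; rewrite ?memvf.
Qed.

Lemma mulmx_col_sum (F : fieldType) r q (M : 'M[F]_(r, q)) (w : 'cV[F]_q) :
  M *m w = \sum_j w j 0 *: col j M.
Proof.
apply/matrixP => i l; rewrite ord1 summxE !mxE; apply: eq_bigr => j _.
by rewrite !mxE mulrC.
Qed.

Lemma span_col (F : fieldType) r q (M : 'M[F]_(r, q)) :
  <<[seq col j M | j : 'I_q]>>%VS = Defs.Im M.
Proof.
apply/eqP; rewrite eqEsubv; apply/andP; split.
  apply/span_subvP => v /mapP [j _ ->].
  by apply/mem_ImP; exists (delta_mx j 0); rewrite colE.
apply/subvP => v /mem_ImP [w ->]; rewrite mulmx_col_sum.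
apply: memv_suml => j _; apply/rpredZ/memv_span.
by apply/mapP; exists j; rewrite ?mem_enum.
Qed.

Section Recursion.
Variables (F : fieldType) (n m p : nat).
Variables (A : 'M[F]_n) (B : 'M[F]_(n, m)) (C : 'M[F]_(p, n)).

Definition cond_step (V : {vspace 'cV[F]_n}) : {vspace 'cV[F]_n} :=
  (mximage A (V :&: Ker C) + Defs.Im B)%VS.

Definition cond_seq (t : nat) : {vspace 'cV[F]_n} := iter t cond_step 0%VS.

Lemma cond_step_mono V W : (V <= W)%VS -> (cond_step V <= cond_step W)%VS.
Proof. by move=> VW; apply/addvS/subvv/limgS/capvS/subvv. Qed.

Lemma cond_seqS t : (cond_seq t <= cond_seq t.+1)%VS.
Proof. by elim: t => [|t IHt]; [apply: sub0v | apply: cond_step_mono]. Qed.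

(** Each strict inclusion raises the dimension by at least one; once two consecutive terms agree,
    applying [cond_step] to both carries the equality to all later terms. *)
Lemma cond_seq_dim t :
  (t <= \dim (cond_seq t))%N \/ cond_seq t.+1 = cond_seq t.
Proof.
elim: t => [|t [IHt|IHt]]; first by left.
- have [/eqP e|ne] := boolP (cond_seq t == cond_seq t.+1).
    by right; exact: (congr1 cond_step (esym e)).
  left; apply: leq_ltn_trans IHt _.
  by rewrite ltnNge; apply: contra ne => le; rewrite eqEdim cond_seqS.
by right; exact: (congr1 cond_step IHt).
Qed.

Lemma cond_seq_stationary t : (n <= t)%N -> cond_seq t.+1 = cond_seq t.
Proof.
move=> nt; have [tdim|//] := cond_seq_dim t.
have le_dim V : (\dim (V : {vspace 'cV[F]_n}) <= n)%N.
  by rewrite (leq_trans (dimvS (subvf V))) // dimvf /dim /= muln1.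
apply/eqP; rewrite eq_sym eqEdim cond_seqS.
exact: leq_trans (le_dim _) (leq_trans nt tdim).
Qed.

Lemma cond_seq_min V t :
  conditioned_invariant A C V -> (Defs.Im B <= V)%VS -> (cond_seq t <= V)%VS.
Proof.
move=> cV BV; elim: t => [|t IHt]; first exact: sub0v.
rewrite subv_add BV andbT; apply: subv_trans cV.
exact/limgS/capvS/subvv.
Qed.

(** By stationarity the term is a fixed point of [cond_step], so it contains both summands of its
    own image: this gives the invariance and the inclusion of [Im B]. *)
Lemma cond_seq_smallest t : (n <= t)%N ->
  smallest_conditioned_invariant A B C (cond_seq t).
Proof.
move=> /cond_seq_stationary e; split.
- by rewrite /conditioned_invariant -[X in (_ <= X)%VS]e addvSl.
- by rewrite -e addvSr.
- by move=> V; apply: cond_seq_min.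
Qed.

Lemma smallest_conditioned_invariant_unique S S' :
  smallest_conditioned_invariant A B C S ->
  smallest_conditioned_invariant A B C S' -> S = S'.
Proof.
move=> [c i s] [c' i' s']; apply/eqP.
by rewrite eqEsubv s // s'.
Qed.

(** Induction on the last step: the summand from [A] supplies the state at time [t], which lies in
    [Ker C], and the summand [Im B] supplies the input [w t]. *)
Lemma mem_cond_seqP t v :
  v \in cond_seq t <->
  exists z : nat -> 'cV[F]_n, exists w : nat -> 'cV[F]_m,
    [/\ z 0%N = 0, z t = v & forall s, (s < t)%N ->
        z s.+1 = A *m z s + B *m w s /\ C *m z s = 0].
Proof.
elim: t v => [|t IHt] v.
  split; last by case=> z [w [z0 <- _]]; rewrite z0 mem0v.
  by rewrite memv0 => /eqP ->; exists (fun=> 0), (fun=> 0).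
split.
  case/memv_addP => _ /mem_mximageP [a + ->] [_ /mem_ImP [b ->] ->].
  rewrite memv_cap mem_Ker => /andP [/IHt [z [w [z0 zt zw]]] /eqP Ca].
  (* The trajectory reaching [a] at time [t] is prolonged by one step with input [b]; only the state
     at [t.+1] and the input at [t] are overwritten. *)
  exists (fun s => if s == t.+1 then A *m a + B *m b else z s).
  exists (fun s => if s == t then b else w s); split=> // [|s].
    by rewrite eqxx.
  rewrite ltnS eqSS => st; rewrite (ltn_eqF (st : s < t.+1)%N).
  move: st; rewrite leq_eqVlt; have [-> _|_] := eqVneq s t.
    by rewrite zt.
  exact: zw.
case=> z [w [z0 <- zw]]; have [-> Czt] := zw t (ltnSn t).
apply: memv_add; last by apply/mem_ImP; exists (w t).
apply/mem_mximageP; exists (z t) => //.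
rewrite memv_cap mem_Ker Czt eqxx andbT; apply/IHt; exists z, w; split=> //.
by move=> s st; apply/zw/ltnW.
Qed.

End Recursion.

(** Superposition of the experiments with weights [g], kept as a signal in time so that the dynamics
    can be applied to it. *)
Definition combine (F : fieldType) (q N : nat) (z : 'I_N -> nat -> 'cV[F]_q)
  (g : 'cV[F]_N) (t : nat) : 'cV[F]_q := \sum_i g i 0 *: z i t.

Lemma columns_mul (F : fieldType) q N (v : 'I_N -> 'cV[F]_q) (g : 'cV[F]_N) :
  columns v *m g = \sum_i g i 0 *: v i.
Proof.
rewrite mulmx_col_sum; apply: eq_bigr => i _; congr (_ *: _).
by apply/matrixP => j l; rewrite !mxE ord1.
Qed.

Lemma columns_stack_mul (F : fieldType) q N T (z : 'I_N -> nat -> 'cV[F]_q)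
    (g : 'cV[F]_N) :
  columns (fun i => stack T (z i)) *m g = stack T (combine z g).
Proof.
rewrite columns_mul; apply/matrixP => j l.
rewrite summxE !mxE /combine summxE; apply: eq_bigr => i _.
by rewrite !mxE.
Qed.

Lemma stack_inj (F : fieldType) q T (z z' : nat -> 'cV[F]_q) :
  stack T z = stack T z' <-> forall t, (t < T)%N -> z t = z' t.
Proof.
pose b (v : nat -> 'cV[F]_q) (t : 'I_T) := v t.
have e := eq_mxcolP (b z) (b z').
split=> [/(iffRL e) zz' t tT|zz']; first exact: (zz' (Ordinal tT)).
by apply/(iffLR e) => t; apply: zz'.
Qed.

Lemma stack0 (F : fieldType) q T : stack T (fun=> 0 : 'cV[F]_q) = 0.
Proof. by apply/matrixP => i j; rewrite !mxE. Qed.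

Lemma last_block_stack (F : fieldType) n T (z : nat -> 'cV[F]_n) :
  last_block F n T.+1 *m stack T.+1 z = z T.
Proof.
rewrite /last_block /stack mul_mxrow_mxcol (bigD1 ord_max) //= eqxx mul1mx.
rewrite big1 ?addr0 // => i ne; rewrite eqSS ifN ?mul0mx //.
Qed.

Lemma experiment_combine (F : fieldType) n m p N T (A : 'M[F]_n) (B : 'M[F]_(n, m))
    (C : 'M[F]_(p, n)) x u y (g : 'cV[F]_N) :
  (forall i, experiment T A B C (x i) (u i) (y i)) ->
  experiment T A B C (combine x g) (combine u g) (combine y g).
Proof.
move=> e t tT; rewrite /combine !mulmx_sumr -big_split /=.
by split; apply: eq_bigr => i _; have [xS yE] := e i t tT;
  rewrite ?xS ?yE ?scalerDr -!scalemxAr.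
Qed.

(** Full row rank makes [pinvmx M] a right inverse of [M]. *)
Lemma full_row_rank_solve (F : fieldType) r q (M : 'M[F]_(r, q)) (b : 'cV[F]_r) :
  \rank M = r -> exists g, M *m g = b.
Proof.
move=> rM; have fM : row_free M by apply/eqP.
by exists (pinvmx M *m b); rewrite mulmxA mulmxVp // mul1mx.
Qed.

Theorem mainTheorem2 (R : realType) (n m p T N k : nat)
  (A : 'M[R]_n) (B : 'M[R]_(n, m)) (C : 'M[R]_(p, n))
  (x : 'I_N -> nat -> 'cV[R]_n) (u : 'I_N -> nat -> 'cV[R]_m)
  (y : 'I_N -> nat -> 'cV[R]_p)
  (X : 'M[R]_(\sum_(t < T) n, N)) (X0 : 'M[R]_(n, N))
  (U : 'M[R]_(\sum_(t < T) m, N)) (Y : 'M[R]_(\sum_(t < T) p, N))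
  (K0 : 'M[R]_(N, k)) (H : 'M[R]_(n, \sum_(t < T) n))
  (hT : (n <= T)%N)
  (hexp : forall i : 'I_N, experiment T A B C (x i) (u i) (y i))
  (hX : X = columns (fun i : 'I_N => stack T (fun t : nat => x i t.+1)))
  (hX0 : X0 = columns (fun i : 'I_N => x i 0%N))
  (hU : U = columns (fun i : 'I_N => stack T (u i)))
  (hY : Y = columns (fun i : 'I_N => stack T (y i)))
  (hPE : \rank (col_mx X0 U) = (n + m * T)%N)
  (hK0 : basis_of (Ker X0) [seq col j K0 | j : 'I_k])
  (hH : H = last_block R n T) :
  forall S : {vspace 'cV[R]_n},
    smallest_conditioned_invariant A B C S <->
    S = mximage (H *m X *m K0) (Ker (Y *m K0)).
Proof.
have kerX0 : Ker X0 = Defs.Im K0 by rewrite -span_col (span_basis hK0).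
have X0E g : X0 *m g = combine x g 0 by rewrite hX0 columns_mul.
have UE g : U *m g = stack T (combine u g) by rewrite hU columns_stack_mul.
have HXE g : X0 *m g = 0 -> H *m X *m g = combine x g T.
  rewrite X0E -mulmxA hX => x0; rewrite (columns_stack_mul T (fun i t => x i t.+1)).
  (* [X] stacks the states from time 1 on, so its last block holds the states at time [T]. If
     [T = 0], then [n = 0] and both sides have no entries. *)
  rewrite hH; case: (T) hT => [|T' _]; last exact: last_block_stack.
  by rewrite leqn0 => /eqP n0; apply/matrixP => i; have := ltn_ord i; rewrite {2}n0.
have YE g : Y *m g = 0 <-> forall t, (t < T)%N -> combine y g t = 0.
  by rewrite hY columns_stack_mul -(stack0 R p T) stack_inj.
(* Persistence of excitation: some weights realise initial state 0 together with any prescribed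
   input sequence [w]. *)
have solve w : exists2 g, X0 *m g = 0 & U *m g = stack T w.
  have [|g] := @full_row_rank_solve _ _ _ (col_mx X0 U) (col_mx 0 (stack T w)).
    by rewrite hPE sum_nat_const card_ord mulnC.
  by rewrite mul_col_mx => /eq_col_mx [? ?]; exists g.
suff e : cond_seq A B C T = mximage (H *m X *m K0) (Ker (Y *m K0)).
  have sm := cond_seq_smallest A B C hT.
  move=> S; rewrite -e; split=> [|->//].
  by move=> sS; apply: smallest_conditioned_invariant_unique sS sm.
apply/vspaceP => v; apply/idP/mem_mximageP.
  case/mem_cond_seqP => z [w [z0 <- zw]].
  have [g X0g] := solve w; rewrite UE => /stack_inj ug.
  (* Both signals start at 0 and receive the same inputs before [T], so the recursion forces them to
     agree up to time [T] included. *)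
  have xz t : (t <= T)%N -> combine x g t = z t.
    elim: t => [|t IHt] tT; first by rewrite z0 -X0E.
    have [-> _] := experiment_combine g hexp tT.
    by have [-> _] := zw t tT; rewrite ug // IHt // ltnW.
  have : g \in Ker X0 by rewrite mem_Ker X0g.
  rewrite kerX0 => /mem_ImP [a ga]; exists a.
    rewrite mem_Ker -mulmxA -ga; apply/eqP/YE => t tT.
    have [_ ->] := experiment_combine g hexp tT.
    by rewrite xz ?(ltnW tT) //; have [] := zw t tT.
  by rewrite -(mulmxA (H *m X)) -ga HXE // xz.
(* Conversely, the weights [K0 *m a] superpose the experiments into a trajectory from 0 whose output
   vanishes before [T]. *)
case=> a; rewrite mem_Ker -!mulmxA => /eqP Y0 ->.
have : K0 *m a \in Ker X0 by rewrite kerX0; apply/mem_ImP; exists a.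
rewrite mem_Ker => /eqP X0a; rewrite mulmxA HXE //.
apply/mem_cond_seqP; exists (combine x (K0 *m a)), (combine u (K0 *m a)).
split=> // [|t tT]; first by rewrite -X0E.
have [-> <-] := experiment_combine (K0 *m a) hexp tT.
by split=> //; move/YE: Y0; apply.
Qed.
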